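(* Let $\mathcal{H}_1,\mathcal{H}_2$ be Hilbert spaces and $A\in L(\mathcal{H}_1,\mathcal{H}_2)$. For every $C\in\mathcal{D}_A$, the equation $A:X=C$ has a solution (i.e. there is an $X\in L(\mathcal{H}_1,\mathcal{H}_2)$ parallel summable with $A$ such that $A:X=C$). Moreover, $C:(-A)$ is the unique solution $X$ which also satisfies $R(A+X)=R(A)$ and $R((A+X)^* )=R(A^* )$.
   Context: $L(\mathcal{H}_1,\mathcal{H}_2)$ is the space of bounded linear operators; $R(\cdot)$, $N(\cdot)$ denote range and nullspace; $|T|=(T^*T)^{1/2}$. $\mathcal{D}_A=\{C\in L(\mathcal{H}_1,\mathcal{H}_2): R(C-A)=R(A)\text{ and }R((C-A)^* )=R(A^* )\}$. Reduced solution: if $R(Y)\subseteq R(X)$, the reduced solution of $XD=Y$ is the unique bounded $D$ with $XD=Y$ and $R(D)\subseteq N(X)^\perp$. $A,B\in L(\mathcal{H}_1,\mathcal{H}_2)$ are parallel summable if $R(A)\subseteq R(A+B)$ and $R(A^* )\subseteq R(A^*+B^* )$. In that case the parallel sum is $A:B=A-F_A^*E_A\in L(\mathcal{H}_1,\mathcal{H}_2)$, where $A+B=U|A+B|$ is the polar decomposition, $E_A$ is the reduced solution of $A=|A^*+B^*|^{1/2}UX$ and $F_A$ is the reduced solution of $A^*=|A+B|^{1/2}X$. (For $C\in\mathcal{D}_A$, the operators $C$ and $-A$ are parallel summable.) *)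

(* Defs.v *)
From HB Require Import structures.
From mathcomp Require Import all_boot all_order all_algebra sesquilinear.
From mathcomp Require Import complex.
From mathcomp Require Import boolp classical_sets functions reals.
From mathcomp Require Import topology normedtype.

Set Implicit Arguments.
Unset Strict Implicit.
Unset Printing Implicit Defensive.

Import Order.TTheory GRing.Theory Num.Theory.
Import numFieldNormedType.Exports.

Local Open Scope classical_set_scope.
Local Open Scope ring_scope.

(* Real and complex Hilbert spaces are treated uniformly: the scalar field is
   either R or R[i], with the corresponding conjugation. *)
Variant scalar_kind := RealScalars | ComplexScalars.

Definition scalars (k : scalar_kind) (R : realType) : numFieldType :=
  match k with RealScalars => R | ComplexScalars => R[i] end.

Definition conj_scalar (k : scalar_kind) (R : realType) :
    scalars k R -> scalars k R :=
  match k with RealScalars => idfun | ComplexScalars => Num.conj end.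

Arguments conj_scalar : clear implicits.

(* The inner product is linear in its first argument and theta-semilinear in
   its second one. *)
HB.mixin Record CompleteNormedModule_isHilbert (K : numFieldType)
    (theta : K -> K) H & CompleteNormedModule K H := {
  inner : {dot H for theta} ;
  inner_norm : forall x : H, inner x x = `|x| ^+ 2
}.

#[short(type="hilbertType")]
HB.structure Definition Hilbert (K : numFieldType) (theta : K -> K) :=
  {H of CompleteNormedModule K H & CompleteNormedModule_isHilbert K theta H}.

Section BoundedOperators.
Context {K : numFieldType} {theta : K -> K}.

Definition bounded_linear (H1 H2 : hilbertType theta) (f : H1 -> H2) : Prop :=
  linear f /\ exists M : K, forall x, `|f x| <= M * `|x|.

Definition bounded_linear_pred (H1 H2 : hilbertType theta) :
  {pred H1 -> H2} := [pred f | `[< bounded_linear f >]].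
Arguments bounded_linear_pred : clear implicits.

Record bop (H1 H2 : hilbertType theta) := Bop {
  bop_fun :> H1 -> H2 ;
  bop_subproof : bop_fun \in bounded_linear_pred H1 H2
}.

Section Structure.
Context {H1 H2 : hilbertType theta}.

HB.instance Definition _ := [isSub for @bop_fun H1 H2].
HB.instance Definition _ := [Choice of bop H1 H2 by <:].

Lemma bopP (T : bop H1 H2) : bounded_linear T.
Proof. exact/asboolP/(bop_subproof T). Qed.

HB.instance Definition _ (T : bop H1 H2) :=
  GRing.isLinear.Build K H1 H2 _ T (proj1 (bopP T)).

Lemma bounded_linear_submod_closed :
  submod_closed (bounded_linear_pred H1 H2).
Proof.
split.
  apply/asboolP; split => [a x y|]; first by rewrite scaler0 addr0.
  by exists 0 => x; rewrite normr0 mul0r.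
move=> a f g /asboolP[flin [M fM]] /asboolP[glin [N gN]].
apply/asboolP; split.
  move=> b x y; rewrite [LHS](_ : _ = a *: f (b *: x + y) + g (b *: x + y))//.
  rewrite [RHS](_ : _ = b *: (a *: f x + g x) + (a *: f y + g y))//.
  by rewrite flin glin !scalerDr !scalerA (mulrC a) addrACA.
exists (`|a| * M + N) => x; rewrite [X in `|X|](_ : _ = a *: f x + g x)//.
rewrite (le_trans (ler_normD _ _))// mulrDl lerD// normrZ -mulrA.
by rewrite ler_wpM2l.
Qed.

HB.instance Definition _ := GRing.isSubmodClosed.Build K (H1 -> H2)
  (bounded_linear_pred H1 H2) bounded_linear_submod_closed.
HB.instance Definition _ := [SubChoice_isSubLmodule of bop H1 H2 by <:].

End Structure.

Lemma bopcomp_subproof (H1 H2 H3 : hilbertType theta)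
  (S : bop H2 H3) (T : bop H1 H2) : S \o T \in bounded_linear_pred H1 H3.
Proof.
have [_ [M TM]] := bopP T; have [_ [N SN]] := bopP S.
apply/asboolP; split => [a x y|]; first by rewrite /= !linearP.
exists (`|N| * M) => x /=; rewrite (le_trans (SN _))//.
have [->|nz] := eqVneq (T x) 0.
  rewrite normr0 mulr0 -mulrA mulr_ge0//.
  exact: le_trans (TM x).
have N0 : 0 <= N.
  rewrite -(pmulr_lge0 _ (_ : 0 < `|T x|)) ?normr_gt0//.
  exact: le_trans (SN _).
by rewrite (ger0_norm N0) -mulrA ler_wpM2l.
Qed.

Definition bopcomp (H1 H2 H3 : hilbertType theta)
  (S : bop H2 H3) (T : bop H1 H2) : bop H1 H3 := Bop (bopcomp_subproof S T).

End BoundedOperators.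

Notation "S \bo T" := (bopcomp S T) (at level 40, left associativity).

Section ParallelSum.
Context {K : numFieldType} {theta : K -> K}.
Implicit Types H : hilbertType theta.

(* The objects below that are characterized by a property ("the adjoint",
   "the positive square root", ...) are obtained by choice; the default value 0
   is only taken when no object with that property exists. *)

Definition adj H1 H2 (T : bop H1 H2) : bop H2 H1 :=
  xget 0 [set S : bop H2 H1 | forall x y, inner (T x) y = inner x (S y)].

Definition nullspace H1 H2 (T : bop H1 H2) : set H1 := [set x | T x = 0].

Definition orthocomplement H (S : set H) : set H :=
  [set x | forall y, S y -> inner x y = 0].

(* Self-adjointness has to be required for real scalars. *)
Definition positive_op H (P : bop H H) : Prop :=
  adj P = P /\ forall x, 0 <= inner (P x) x.

Definition sqrt_op H (P : bop H H) : bop H H :=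
  xget 0 [set Q : bop H H | positive_op Q /\ Q \bo Q = P].

Definition abs_op H1 H2 (T : bop H1 H2) : bop H1 H1 := sqrt_op (adj T \bo T).

Definition partial_isometry H1 H2 (U : bop H1 H2) : Prop :=
  forall x, orthocomplement (nullspace U) x -> `|U x| = `|x|.

(* The partial isometry U of the polar decomposition T = U |T|. *)
Definition polar_factor H1 H2 (T : bop H1 H2) : bop H1 H2 :=
  xget 0 [set U : bop H1 H2 | [/\ partial_isometry U,
    nullspace U = nullspace T & T = U \bo abs_op T]].

Definition reduced_solution H1 H2 H3 (X : bop H2 H3) (Y : bop H1 H3) :
    bop H1 H2 :=
  xget 0 [set D : bop H1 H2 |
    X \bo D = Y /\ range D `<=` orthocomplement (nullspace X)].

Definition parallel_summable H1 H2 (A B : bop H1 H2) : Prop :=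
  range A `<=` range (A + B) /\ range (adj A) `<=` range (adj A + adj B).

(* Meaningful when A and B are parallel summable. *)
Definition parallel_sum H1 H2 (A B : bop H1 H2) : bop H1 H2 :=
  let U := polar_factor (A + B) in
  let E := reduced_solution (sqrt_op (abs_op (adj A + adj B)) \bo U) A in
  let F := reduced_solution (sqrt_op (abs_op (A + B))) (adj A) in
  A - adj F \bo E.

Definition same_range_perturbations H1 H2 (A : bop H1 H2) : set (bop H1 H2) :=
  [set C | range (C - A) = range A /\ range (adj (C - A)) = range (adj A)].

End ParallelSum.

(* Main.v *)
(* The parallel sum is [A : B = A - A (A + B)^-1 A], read as follows: if
   [(A + B) y = A x] then [(A : B) x = A x - A y]; such a [y] exists, and [A y]
   does not depend on it because the nullspace of [A + B] is contained in that
   of [A].  With [T = C - A], the operators [A] and [T] have the same range and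
   nullspace, and so do their adjoints.  Solving [T w = A x] gives
   [(A + (C : (-A))) x = - A w], and the claims on [X = C : (-A)] become
   statements about preimages.
   The formula for [A : B] follows from [|T^*|^(1/2) U = U |T|^(1/2)] for the
   polar decomposition [T = U |T|], which comes from the uniqueness of positive
   square roots. *)
Require Import Defs.
From HB Require Import structures.
From mathcomp Require Import all_boot all_order all_algebra sesquilinear.
From mathcomp Require Import complex.
From mathcomp Require Import boolp classical_sets functions reals.
From mathcomp Require Import topology normedtype.
From mathcomp Require Import lra.

Set Implicit Arguments.
Unset Strict Implicit.
Unset Printing Implicit Defensive.

Import Order.TTheory GRing.Theory Num.Theory.
Import numFieldNormedType.Exports.

Local Open Scope classical_set_scope.
Local Open Scope ring_scope.

(** * Real parts and the embedded reals, for both scalar fields at once *)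

Section Scalars.
Context {k : scalar_kind} {R : realType}.
Local Notation K := (scalars k R).

Definition re : K -> R :=
  match k return scalars k R -> R with
  | RealScalars => idfun
  | ComplexScalars => @complex.Re R
  end.

Definition inj : R -> K :=
  match k return R -> scalars k R with
  | RealScalars => idfun
  | ComplexScalars => real_complex R
  end.

Lemma reD x y : re (x + y) = re x + re y.
Proof. by rewrite /re; case: k x y => //= -[a b] [c d]. Qed.

Lemma reM r x : re (inj r * x) = r * re x.
Proof.
by rewrite /re /inj; case: k x => //= -[a b] /=; rewrite mul0r subr0.
Qed.

Lemma injK : cancel inj re.
Proof. by rewrite /re /inj; case: k. Qed.

(** The order of [R[i]] compares only numbers with equal imaginary parts, so anything above 0 is
    real. *)
Lemma inj_re_ge0 x : 0 <= x -> x = inj (re x).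
Proof.
rewrite /re /inj; case: k x => //= -[a b] /=.
by rewrite lecE /= => /andP[/eqP -> _].
Qed.

Lemma injD r s : inj (r + s) = inj r + inj s.
Proof. by rewrite /inj; case: k => //=; rewrite rmorphD. Qed.

Lemma injM r s : inj (r * s) = inj r * inj s.
Proof. by rewrite /inj; case: k => //=; rewrite rmorphM. Qed.

Lemma inj1 : inj 1 = 1.
Proof. by rewrite /inj; case: k => //=; rewrite rmorph1. Qed.

Lemma ler_inj r s : (inj r <= inj s) = (r <= s).
Proof. by rewrite /inj; case: k => //=; rewrite lecR. Qed.

Lemma ltr_inj r s : (inj r < inj s) = (r < s).
Proof. by rewrite /inj; case: k => //=; rewrite ltcR. Qed.

Lemma re_conj x : re (conj_scalar k R x) = re x.
Proof. by rewrite /re /conj_scalar; case: k x => //= -[a b]. Qed.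

(** The real part here is the squared modulus of [x]. This is the bridge from real parts of inner
    products back to the inner products themselves. *)
Lemma re_mulJ_eq0 x : re (conj_scalar k R x * x) = 0 -> x = 0.
Proof.
rewrite /re /conj_scalar; case: k x => //= [x|[a b]] /=.
  by move/eqP; rewrite mulf_eq0 orbb => /eqP.
rewrite mulNr opprK => /eqP; rewrite paddr_eq0 -?expr2 ?sqr_ge0//.
by rewrite !sqrf_eq0 => /andP[/eqP -> /eqP ->].
Qed.

End Scalars.
Arguments inj : clear implicits.

(** * The underlying real inner product space and completeness *)

Section Geometry.
Context {k : scalar_kind} {R : realType}.
Local Notation K := (scalars k R).
Local Notation theta := (conj_scalar k R).
Local Notation inj := (inj k R).
Implicit Types H : hilbertType (conj_scalar k R).

(* All estimates are carried out in the underlying real inner product space;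
   [rip] determines [inner] (see [inner_of_rip]). *)
Definition rnorm H (x : H) : R := re `|x|.
Definition rip H (x y : H) : R := re (inner x y).

Lemma inj0 : inj 0 = 0.
Proof. by apply: (addrI (inj 0)); rewrite -injD !addr0. Qed.

Lemma re0 : re (0 : K) = 0.
Proof. by rewrite -inj0 injK. Qed.

Lemma reN (x : K) : re (- x) = - re x.
Proof. by apply/eqP; rewrite -addr_eq0 -reD addNr re0. Qed.

Lemma inj_rnorm H (x : H) : inj (rnorm x) = `|x|.
Proof. by rewrite /rnorm -inj_re_ge0. Qed.

Lemma rnorm_ge0 H (x : H) : 0 <= rnorm x.
Proof. by rewrite -(@ler_inj k) inj_rnorm inj0. Qed.

Lemma rnormD H (x y : H) : rnorm (x + y) <= rnorm x + rnorm y.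
Proof. by rewrite -(@ler_inj k) injD !inj_rnorm ler_normD. Qed.

Lemma rnorm0 H : rnorm (0 : H) = 0.
Proof. by rewrite /rnorm normr0 re0. Qed.

Lemma rnorm_eq0 H (x : H) : rnorm x = 0 -> x = 0.
Proof. by move=> Nx0; apply/eqP; rewrite -normr_eq0 -inj_rnorm Nx0 inj0. Qed.

Lemma ripxx H (x : H) : rip x x = rnorm x ^+ 2.
Proof. by rewrite /rip inner_norm -inj_rnorm expr2 reM injK. Qed.

Lemma innerC H (x y : H) : inner x y = theta (inner y x).
Proof. by rewrite (hermitian_subproof x y) expr0 mul1r. Qed.

Lemma ripC H (x y : H) : rip x y = rip y x.
Proof. by rewrite /rip innerC re_conj. Qed.

Lemma ripDl H (x y z : H) : rip (x + y) z = rip x z + rip y z.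
Proof. by rewrite /rip linearDl reD. Qed.

Lemma ripDr H (x y z : H) : rip z (x + y) = rip z x + rip z y.
Proof. by rewrite ripC ripDl !(ripC z). Qed.

Lemma ripNl H (x y : H) : rip (- x) y = - rip x y.
Proof. by rewrite /rip linearNl reN. Qed.

Lemma ripNr H (x y : H) : rip x (- y) = - rip x y.
Proof. by rewrite ripC ripNl ripC. Qed.

Lemma rip0l H (x : H) : rip 0 x = 0.
Proof. by rewrite /rip linear0l re0. Qed.

Lemma rip0r H (x : H) : rip x 0 = 0.
Proof. by rewrite ripC rip0l. Qed.

Lemma innerZl H (a : K) (x y : H) : inner (a *: x) y = a * inner x y.
Proof. by rewrite linearZl_LR. Qed.

Lemma innerZr H (a : K) (x y : H) : inner x (a *: y) = theta a * inner x y.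
Proof. by rewrite linearZr_LR. Qed.

Lemma ripZl H r (x y : H) : rip (inj r *: x) y = r * rip x y.
Proof. by rewrite /rip innerZl reM. Qed.

Lemma ripZr H r (x y : H) : rip x (inj r *: y) = r * rip x y.
Proof. by rewrite ripC ripZl ripC. Qed.

Lemma ripZr_conj H (a : K) (x y : H) : rip x (a *: y) = rip (theta a *: x) y.
Proof. by rewrite /rip innerZl innerZr. Qed.

Lemma rnormZ H r (x : H) : rnorm (inj r *: x) = `|r| * rnorm x.
Proof.
apply: (@pexpIrn _ 2) => //; rewrite ?nnegrE ?rnorm_ge0 ?mulr_ge0 ?rnorm_ge0//.
by rewrite -ripxx ripZl ripZr ripxx exprMn real_normK ?num_real// mulrA expr2.
Qed.

Lemma rnormN H (x : H) : rnorm (- x) = rnorm x.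
Proof. by rewrite /rnorm normrN. Qed.

Lemma rnorm_subC H (x y : H) : rnorm (x - y) = rnorm (y - x).
Proof. by rewrite -rnormN opprB. Qed.

(** Cauchy-Schwarz, obtained by squaring the triangle inequality of the norm. *)
Lemma rip_le H (x y : H) : rip x y <= rnorm x * rnorm y.
Proof.
have := rnormD x y; rewrite -ler_sqr ?nnegrE ?addr_ge0 ?rnorm_ge0//.
rewrite -ripxx !(ripDl, ripDr) !ripxx (ripC y) => h.
by nra.
Qed.

Lemma norm_rip_le H (x y : H) : `|rip x y| <= rnorm x * rnorm y.
Proof. by rewrite ler_norml rip_le lerNl -ripNl -(rnormN x) rip_le. Qed.

Lemma rip_eq0 H (x : H) : (forall y, rip y x = 0) -> x = 0.
Proof.
by move=> /(_ x); rewrite ripxx => /eqP; rewrite sqrf_eq0 => /eqP/rnorm_eq0.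
Qed.

Lemma rip_inj H (x z : H) : (forall y, rip y x = rip y z) -> x = z.
Proof.
move=> h; apply/eqP; rewrite -subr_eq0; apply/eqP/rip_eq0 => y.
by rewrite ripDr ripNr h subrr.
Qed.

(** The Archimedean property, in the form that ends most limit arguments below: approximations carry
    explicit errors of order [1 / n.+1]. *)
Lemma le0_harmonic (a c : R) : (forall n : nat, a <= c / n.+1%:R) -> a <= 0.
Proof.
move=> h; rewrite leNgt; apply/negP => a0.
have := h (Num.truncn (c / a)); rewrite ler_pdivlMr ?ltr0n// leNgt.
by rewrite mulrC -ltr_pdivrMr// truncnS_gt.
Qed.

Lemma complete_harmonic H (u : nat -> H) (b : nat -> R) (c : R) :
  (forall n m, (n <= m)%N -> rnorm (u m - u n) <= b n) ->
  (forall n, b n <= c / n.+1%:R) ->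
  exists z, forall n, rnorm (z - u n) <= b n.
Proof.
move=> ub bc.
have ltE (x : H) (e : K) : 0 < e -> rnorm x < re e -> `|x| < e.
  by move=> e0; rewrite -inj_rnorm [in X in _ -> X](inj_re_ge0 (ltW e0)) ltr_inj.
have small (e : K) : 0 < e -> exists n, b n < re e.
  move=> e0; apply/not_existsP => h; suff /(lt_le_trans e0) : e <= 0 by rewrite ltxx.
  rewrite (inj_re_ge0 (ltW e0)) -inj0 ler_inj; apply: (@le0_harmonic _ c) => n.
  by apply: le_trans (bc n); rewrite leNgt; apply/negP/h.
have /cvg_ex[z uz] : cvg (u @ \oo).
  apply/cauchy_cvgP/cauchy_exP => e e0; rewrite /fmapE -ball_normE /ball_.
  have [n bn] := small e e0; exists (u n), n => // m nm /=.
  by apply: ltE => //; rewrite rnorm_subC (le_lt_trans (ub _ _ nm)).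
(* Comparing [z] with a late term, at index [maxn n p], loses an arbitrarily small amount, so the
   bound [b n] survives in the limit. *)
exists z => n; rewrite -subr_le0; apply: (@le0_harmonic _ 1) => m.
have e0 : 0 < inj m.+1%:R^-1 by rewrite -inj0 ltr_inj invr_gt0 ltr0n.
have /cvgrPdist_lt/(_ _ e0)[p _ /(_ (maxn n p))] := uz.
rewrite /= leq_maxr => /(_ isT); rewrite -inj_rnorm ltr_inj => h.
have := ub _ _ (leq_maxl n p); 
have := rnormD (z - u (maxn n p)) (u (maxn n p) - u n).
rewrite addrA subrK => h1 h2; rewrite mul1r lerBlDr (le_trans h1)//.
by rewrite lerD// ltW.
Qed.

End Geometry.

(** * Bounded operators and factorization under majorization *)

Section Operators.
Context {k : scalar_kind} {R : realType}.
Local Notation K := (scalars k R).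
Local Notation theta := (conj_scalar k R).
Local Notation inj := (inj k R).
Implicit Types H : hilbertType (conj_scalar k R).

Lemma bop_ext H1 H2 (S T : bop H1 H2) : S =1 T -> S = T.
Proof. by move=> ST; apply: val_inj; apply/funext. Qed.

Lemma bop_addE H1 H2 (S T : bop H1 H2) x : (S + T) x = S x + T x.
Proof. by []. Qed.

Lemma bop_oppE H1 H2 (T : bop H1 H2) x : (- T) x = - T x.
Proof. by []. Qed.

Lemma bop_scaleE H1 H2 a (T : bop H1 H2) x : (a *: T) x = a *: T x.
Proof. by []. Qed.

Lemma bop_zeroE H1 H2 x : (0 : bop H1 H2) x = 0.
Proof. by []. Qed.

Lemma bopD H1 H2 (T : bop H1 H2) x y : T (x + y) = T x + T y.
Proof. exact: linearD. Qed.

Lemma bopN H1 H2 (T : bop H1 H2) x : T (- x) = - T x.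
Proof. exact: linearN. Qed.

Lemma bopB H1 H2 (T : bop H1 H2) x y : T (x - y) = T x - T y.
Proof. exact: linearB. Qed.

Lemma bopZ H1 H2 (T : bop H1 H2) a x : T (a *: x) = a *: T x.
Proof. exact: linearZ. Qed.

Lemma bop0 H1 H2 (T : bop H1 H2) : T 0 = 0.
Proof. exact: linear0. Qed.

Lemma bop_bound H1 H2 (T : bop H1 H2) :
  exists2 M, 0 <= M & forall x, rnorm (T x) <= M * rnorm x.
Proof.
(* On a trivial space [M] may be any scalar, hence the modulus. *)
have [_ [M TM]] := bopP T; exists (re `|M|).
  by rewrite -(@ler_inj k) inj0 -inj_re_ge0.
move=> x; rewrite -(@ler_inj k) injM !inj_rnorm -inj_re_ge0//.
rewrite -[leRHS]ger0_norm ?mulr_ge0// normrM normr_id -normrM.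
by rewrite (le_trans (TM x))// real_ler_norm// ger0_real// (le_trans _ (TM x)).
Qed.

Lemma bop_of_bounded H1 H2 (f : H1 -> H2) (M : R) :
  linear f -> (forall x, rnorm (f x) <= M * rnorm x) ->
  exists T : bop H1 H2, T =1 f.
Proof.
move=> flin fM.
have fP : f \in @bounded_linear_pred _ _ H1 H2.
  apply/asboolP; split=> //; exists (inj M) => x.
  by rewrite -!inj_rnorm -injM ler_inj.
by exists (Bop fP).
Qed.

Lemma idbop_ex H : exists T : bop H H, T =1 id.
Proof. by apply: (@bop_of_bounded _ _ _ 1) => // x; rewrite mul1r. Qed.

(* Minimizes [rnorm (L w) ^+ 2 - 2 * rip (S w) y] over [w]. *)
Lemma majorized_riesz H1 H2 H3 (L : bop H1 H2) (S : bop H1 H3) M (y : H3) :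
  0 <= M -> (forall w, rnorm (S w) <= M * rnorm (L w)) ->
  exists z, [/\ forall w, rip (L w) z = rip (S w) y,
    forall u, (forall w, rip (L w) u = 0) -> rip z u = 0 &
    rnorm z <= M * rnorm y].
Proof.
move=> M0 SL.
pose f w := rip (S w) y.
have fD v w : f (v + w) = f v + f w by rewrite /f bopD ripDl.
have fZ r w : f (inj r *: w) = r * f w by rewrite /f bopZ ripZl.
have fM w : f w <= M * rnorm (L w) * rnorm y.
  by rewrite (le_trans (rip_le _ _))// ler_wpM2r// rnorm_ge0.
pose phi w := rip (L w) (L w) - f w *+ 2.
pose d := inf (range phi).
have phi_inf : has_inf (range phi).
  split; first by exists (phi 0); exists 0.
  (* The lower bound comes from completing the square in [rnorm (L w)]. *)
  exists (- (M * rnorm y) ^+ 2) => _ [w _ <-]; rewrite /phi ripxx.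
  have := fM w; have := sqr_ge0 (rnorm (L w) - M * rnorm y); nra.
have d_le w : d <= phi w by apply: (ge_inf phi_inf.2); exists w.
pose e n : R := n.+1%:R^-1.
have e0 n : 0 < e n by rewrite invr_gt0 ltr0n.
have e_anti n m : (n <= m)%N -> e m <= e n.
  by move=> nm; rewrite lef_pV2 ?posrE ?ltr0n// ler_nat.
have /choice[w wP] n : exists w, phi w <= d + e n ^+ 2.
  have [_ [w _ <-]] := inf_adherent (exprn_gt0 2 (e0 n)) phi_inf.
  by move=> /ltW; exists w.
(* Parallelogram law: the squared distance is [2 * (phi (w m) + phi (w n))] minus four times [phi]
   at the midpoint, and the latter is at least [d]. *)
have wC n m : (n <= m)%N -> rnorm (L (w m) - L (w n)) <= 2 * e n.
  move=> nm; rewrite -ler_sqr ?nnegrE ?rnorm_ge0 ?mulr_ge0 ?(ltW (e0 _))// -ripxx.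
  have := d_le (inj 2^-1 *: (w m + w n)).
  rewrite /phi bopZ bopD /= ripZl ripZr fZ fD.
  have := wP n; have := wP m; rewrite /phi.
  rewrite !(ripDl, ripDr, ripNl, ripNr) (ripC (L (w n)) (L (w m))).
  have : e m ^+ 2 <= e n ^+ 2.
    by rewrite ler_sqr ?nnegrE ?(ltW (e0 _))// e_anti.
  by lra.
have [|z zP] := complete_harmonic wC (c := 2).
  by move=> n; rewrite /e.
have close u n : `|rip z u - rip (L (w n)) u| <= 2 * e n * rnorm u.
  by rewrite -ripNl -ripDl (le_trans (norm_rip_le _ _))// ler_wpM2r// rnorm_ge0.
have eq0 (x c : R) : (forall n, `|x| <= c * e n) -> x = 0.
  move=> h; apply/eqP; rewrite -normr_eq0 eq_le normr_ge0 andbT.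
  exact: le0_harmonic h.
have zE v : rip (L v) z = f v.
  apply/eqP; rewrite -subr_eq0; apply/eqP.
  pose q := rip (L v) (L v).
  apply: (eq0 _ ((1 + q) / 2 + 2 * rnorm (L v))) => n.
  have := close (L v) n; rewrite (ripC z).
  (* Since [w n] minimizes up to [e n ^+ 2], steps [t] of size [e n] in either direction bound the
     first variation by a multiple of [e n]. *)
  have var t : 0 <= e n ^+ 2 + 2 * t * (rip (L (w n)) (L v) - f v) + t ^+ 2 * q.
    have := d_le (w n + inj t *: v); have := wP n; rewrite /phi.
    rewrite fD fZ bopD bopZ /= !(ripDl, ripDr) !ripZl !ripZr.
    rewrite (ripC (L v) (L (w n))) -/q expr2 => h1 h2.
    nra.
  have h1 := var (e n); have h2 := var (- e n).
  move=> h3.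
  have h4 : `|rip (L (w n)) (L v) - f v| <= e n * (1 + q) / 2.
    rewrite ler_norml; move: (e0 n) h1 h2.
    set g := rip _ _ - _; set E := e n => E0 h1 h2.
    by apply/andP; split; rewrite -(ler_pM2l E0); lra.
  have := ler_normD (rip (L v) z - rip (L (w n)) (L v))
    (rip (L (w n)) (L v) - f v).
  rewrite addrA subrK => /le_trans; apply.
  by move: (lerD h3 h4); lra.
exists z; split=> //.
- move=> u Lu; apply: (eq0 _ (2 * rnorm u)) => n.
  by have := close u n; rewrite Lu subr0 mulrAC.
- have [|z0] := eqVneq (rnorm z) 0.
    by move=> ->; rewrite mulr_ge0// rnorm_ge0.
  have {z0} zgt : 0 < rnorm z by rewrite lt_neqAle eq_sym z0 rnorm_ge0.
  (* As [z] is the limit of [L (w n)], [rip z z] is the limit of [f (w n)], which [fM] bounds. *)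
  rewrite -(ler_pM2r zgt) -expr2 -ripxx -subr_le0.
  apply: (le0_harmonic (c := 2 * rnorm z + M * 2 * rnorm y)) => n; rewrite -/(e n).
  have /ler_normlP[_] := close z n; have := fM (w n); rewrite /f.
  rewrite -/(f _) zE => h1 h2.
  have h3 : rnorm (L (w n)) <= rnorm z + 2 * e n.
    have := rnormD z (L (w n) - z); rewrite subrKC => /le_trans; apply.
    by rewrite lerD2l rnorm_subC.
  have : M * rnorm (L (w n)) * rnorm y <= M * (rnorm z + 2 * e n) * rnorm y.
    by rewrite ler_wpM2r ?rnorm_ge0// ler_wpM2l.
  by move: (e n) h1 h2 => E h1 h2 h4; lra.
Qed.

(* A form of the Douglas factorization lemma: [L^* D = S^*]. *)
Lemma majorized_factor H1 H2 H3 (L : bop H1 H2) (S : bop H1 H3) M :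
  0 <= M -> (forall w, rnorm (S w) <= M * rnorm (L w)) ->
  exists D : bop H3 H2, [/\ forall w y, rip (L w) (D y) = rip (S w) y,
    forall y u, (forall w, rip (L w) u = 0) -> rip (D y) u = 0 &
    forall y, rnorm (D y) <= M * rnorm y].
Proof.
move=> M0 SL.
have /choice[f fP] y := majorized_riesz y M0 SL.
(* The difference of two candidates is orthogonal to the range of [L], hence to itself. Linearity of
   [f] follows from this uniqueness. *)
have uniq y z : (forall w, rip (L w) z = rip (S w) y) ->
    (forall u, (forall w, rip (L w) u = 0) -> rip z u = 0) -> z = f y.
  have [h1 h2 _] := fP y => g1 g2; apply/eqP; rewrite -subr_eq0; apply/eqP.
  have o w : rip (L w) (z - f y) = 0 by rewrite ripDr ripNr g1 h1 subrr.
  apply: rnorm_eq0; apply/eqP; rewrite -sqrf_eq0 -ripxx ripDl ripNl.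
  by rewrite g2// h2// subrr.
have flin : linear f.
  move=> a x y; have [hx1 hx2 _] := fP x; have [hy1 hy2 _] := fP y.
  symmetry; apply: uniq => [w|u Lu].
    by rewrite !ripDr hy1 !ripZr_conj -!bopZ hx1.
  rewrite ripDl hy2// addr0 ripC ripZr_conj ripC hx2// => w.
  by rewrite ripZr_conj -bopZ.
have [D DE] := bop_of_bounded flin (fun y => let: And3 _ _ h := fP y in h).
by exists D; split=> [w y|y u|y]; rewrite DE; have [] := fP y; auto.
Qed.
End Operators.

(** * Adjoints, uniform boundedness and the Douglas lemma *)

Section Adjoint.
Context {k : scalar_kind} {R : realType}.
Local Notation K := (scalars k R).
Local Notation theta := (conj_scalar k R).
Local Notation inj := (inj k R).
Implicit Types H : hilbertType (conj_scalar k R).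

(** Testing the hypothesis at [theta d *: x], with [d] the difference of the two sides, shows that
    [d] has modulus 0. *)
Lemma inner_of_rip H1 H2 (T : bop H1 H2) y z :
  (forall x, rip (T x) y = rip x z) -> forall x, inner (T x) y = inner x z.
Proof.
move=> h x; apply/eqP; rewrite -subr_eq0; apply/eqP/re_mulJ_eq0.
set d := (X in _ * X); rewrite mulrBr reD reN -!innerZl -bopZ.
by rewrite -!/(rip _ _) h subrr.
Qed.

(** The adjoint exists by [majorized_factor] with [L] the identity, which is the Riesz
    representation of all the functionals [rip (T x) y] at once. *)
Lemma rip_adjl H1 H2 (T : bop H1 H2) x y : rip (T x) y = rip x (adj T y).
Proof.
suff [S SP] : exists S : bop H2 H1, forall x y, inner (T x) y = inner x (S y).
  have /(xgetPex 0)/= adjP : [set S : bop H2 H1 |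
    forall x y, inner (T x) y = inner x (S y)] !=set0 by exists S.
  by rewrite /rip adjP.
have [I IE] := idbop_ex H1; have [M M0 TM] := bop_bound T.
have [|D [DP _ _]] := @majorized_factor _ _ _ _ _ I T M M0.
  by move=> w; rewrite IE.
by exists D => u v; apply: inner_of_rip => w; rewrite -DP IE.
Qed.

Lemma rip_adjr H1 H2 (T : bop H1 H2) x y : rip x (T y) = rip (adj T x) y.
Proof. by rewrite ripC rip_adjl ripC. Qed.

Lemma adj_unique H1 H2 (T : bop H1 H2) (S : bop H2 H1) :
  (forall x y, rip (T x) y = rip x (S y)) -> adj T = S.
Proof. by move=> TS; apply/bop_ext => y; apply: rip_inj => x; rewrite -rip_adjl. Qed.

Lemma adjK H1 H2 (T : bop H1 H2) : adj (adj T) = T.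
Proof. by apply: adj_unique => x y; rewrite rip_adjr. Qed.

Lemma adjD H1 H2 (S T : bop H1 H2) : adj (S + T) = adj S + adj T.
Proof.
by apply: adj_unique => x y; rewrite !bop_addE ripDl ripDr !rip_adjl.
Qed.

Lemma adjN H1 H2 (T : bop H1 H2) : adj (- T) = - adj T.
Proof. by apply: adj_unique => x y; rewrite !bop_oppE ripNl ripNr rip_adjl. Qed.

Lemma adjM H1 H2 H3 (S : bop H2 H3) (T : bop H1 H2) :
  adj (S \bo T) = adj T \bo adj S.
Proof. by apply: adj_unique => x y /=; rewrite !rip_adjl. Qed.

Lemma adjZ H1 H2 r (T : bop H1 H2) : adj (inj r *: T) = inj r *: adj T.
Proof. by apply: adj_unique => x y; rewrite !bop_scaleE ripZl ripZr rip_adjl. Qed.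

(* Gliding hump: [x (n+1)] is within [3^-n] of [x n] and sees [v (s n)]
   on the scale [3^-n]; the later moves change this by at most one half. *)
Lemma weakly_bounded H (I : Type) (v : I -> H) :
  (forall x, exists B, forall i, `|rip x (v i)| <= B) ->
  exists2 M, 0 <= M & forall i, rnorm (v i) <= M.
Proof.
move=> wb; apply: contrapT => unb.
have r0 n : 0 < 3 ^- n :> R by rewrite invr_gt0 exprn_gt0.
(* Half of [3 ^- n * rnorm (v (s n))] will survive the later moves; this threshold makes that half
   exceed [n]. *)
have /choice[s sP] (n : nat) : exists i, 2 * n%:R * 3 ^+ n < rnorm (v i).
  apply: contrapT => h; apply: unb; exists (2 * n%:R * 3 ^+ n).
    by rewrite !mulr_ge0// exprn_ge0.
  by move=> i; rewrite leNgt; apply/negP => vi; apply: h; exists i.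
pose w n := v (s n).
have w0 n : 0 < rnorm (w n).
  by apply: le_lt_trans (sP n); rewrite !mulr_ge0// exprn_ge0.
have /choice[g gP] (p : nat * H) : exists x',
    rnorm (x' - p.2) <= 3 ^- p.1 /\ 3 ^- p.1 * rnorm (w p.1) <= `|rip x' (w p.1)|.
  case: p => n x /=.
  pose u := inj (3 ^- n / rnorm (w n)) *: w n.
  have Nu : rnorm u = 3 ^- n.
    by rewrite rnormZ ger0_norm ?divr_ge0 ?(ltW (r0 _)) ?rnorm_ge0// divfK ?gt_eqF.
  have ru : rip u (w n) = 3 ^- n * rnorm (w n).
    by rewrite ripZl ripxx expr2 mulrA divfK ?gt_eqF.
  (* The move has the sign of [rip x (w n)], so the two contributions cannot cancel. *)
  have [x0|x0] := leP 0 (rip x (w n)).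
    exists (x + u); rewrite [x + u]addrC addrK Nu; split=> //.
    by rewrite ripDl ru (le_trans _ (ler_norm _))// lerDl.
  exists (x - u); rewrite [x - u]addrC addrK rnormN Nu; split=> //.
  by rewrite ripDl ripNl ru ler_normr opprD opprK lerDl oppr_ge0 (ltW x0) orbT.
pose x := fix x n := if n is m.+1 then g (m, x m) else 0.
(* [3 / 2 * 3 ^- n] is the full geometric tail starting at [3 ^- n]; at index [n.+1] it equals
   [3 ^- n / 2]. *)
have xC n m : (n <= m)%N -> rnorm (x m - x n) <= 3 / 2 * 3 ^- n.
  move=> /subnKC <-; move: (m - n)%N => {}m.
  suff : rnorm (x (n + m)%N - x n) <= 3 / 2 * 3 ^- n - 3 / 2 * 3 ^- (n + m).
    by have := r0 (n + m)%N; lra.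
  elim: m => [|m IH]; first by rewrite addn0 !subrr rnorm0.
  rewrite addnS; have [/= h _] := gP ((n + m)%N, x (n + m)%N).
  have := rnormD (x (n + m).+1 - x (n + m)%N) (x (n + m)%N - x n).
  rewrite addrA subrK => /le_trans; apply; rewrite (le_trans (lerD h IH))//.
  by rewrite exprS invfM; lra.
have [|z zP] := complete_harmonic xC (c := 3 / 2).
  move=> n; rewrite ler_pM2l ?divr_gt0 ?ltr0n// lef_pV2 ?posrE ?exprn_gt0 ?ltr0n//.
  by rewrite -natrX ler_nat ltn_expl.
have [B zB] := wb z.
have big n : n%:R <= B.
  apply: le_trans (zB (s n)).
  have [_ /= h1] := gP (n, x n).
  have h2 := norm_rip_le (z - x n.+1) (w n).
  have h3 := zP n.+1.
  have h4 : rnorm (z - x n.+1) * rnorm (w n) <= 3 ^- n / 2 * rnorm (w n).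
    by rewrite ler_pM2r// (le_trans h3)// exprS invfM; lra.
  have h5 := ler_normB (rip z (w n)) (rip (z - x n.+1) (w n)).
  move: h5; rewrite -ripNl -ripDl opprB addrCA subrr addr0 => h5.
  have h6 : n%:R <= 3 ^- n / 2 * rnorm (w n).
    have := sP n; rewrite -/(w n) => /ltW h.
    have := ler_wpM2l (ltW (r0 n)) h.
    by rewrite [leLHS]mulrC mulfK ?gt_eqF ?exprn_gt0//; lra.
  rewrite -/(w n); move: h1 h2 h4 h5 h6; rewrite -[g (n, x n)]/(x n.+1); lra.
have := big (Num.truncn B).+1; rewrite leNgt truncnS_gt//.
Qed.

(** Uniform boundedness for the vectors [adj Y w] scaled by the inverse of [rnorm (adj X w)]: if
    [Y x = X z], their pairings with [x] are at most [rnorm z]. *)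
Lemma range_majorization H1 H2 H3 (Y : bop H1 H3) (X : bop H2 H3) :
  range Y `<=` range X ->
  exists2 M, 0 <= M & forall w, rnorm (adj Y w) <= M * rnorm (adj X w).
Proof.
move=> YX.
pose v w := inj (rnorm (adj X w))^-1 *: adj Y w.
have [x|M M0 vM] := @weakly_bounded _ _ v.
  have [z _ zx] : range X (Y x) by apply: YX; exists x.
  exists (rnorm z) => w; rewrite /v ripZr -rip_adjl -zx rip_adjl normrM normfV.
  rewrite (ger0_norm (rnorm_ge0 _)) mulrC.
  have := rnorm_ge0 (adj X w); rewrite le0r => /orP[/eqP ->|n0].
    by rewrite invr0 mulr0 rnorm_ge0.
  by rewrite ler_pdivrMr// norm_rip_le.
exists M => // w; have := vM w; rewrite /v rnormZ normfV (ger0_norm (rnorm_ge0 _)).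
(* If [adj X w = 0], the inverse takes its default value 0 and [v w] carries no information;
   [adj Y w = 0] then follows from the range inclusion. *)
have := rnorm_ge0 (adj X w); rewrite le0r => /orP[/eqP n0 _|n0].
  rewrite (_ : adj Y w = 0) ?rnorm0 ?mulr_ge0 ?rnorm_ge0//.
  apply: rip_eq0 => x; have [z _ zx] : range X (Y x) by apply: YX; exists x.
  by rewrite -rip_adjl -zx rip_adjl (rnorm_eq0 n0) rip0r.
by rewrite mulrC ler_pdivrMr.
Qed.

(** Majorization of the adjoints yields the factor [D]; the orthogonality clause says that it is the
    reduced solution. *)
Lemma douglas H1 H2 H3 (Y : bop H1 H3) (X : bop H2 H3) :
  range Y `<=` range X ->
  exists2 D : bop H1 H2, X \bo D = Y &
    forall y u, X u = 0 -> rip (D y) u = 0.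
Proof.
move=> /range_majorization[M M0 YX].
have [D [DP Do _]] := majorized_factor M0 YX.
exists D => [|y u Xu].
  by apply/bop_ext => y; apply: rip_inj => w /=; rewrite rip_adjr DP -rip_adjr.
by apply: Do => w; rewrite -rip_adjr Xu rip0r.
Qed.

End Adjoint.

(** * Positive operators and norm limits of operators *)

Section SquareRoot.
Context {k : scalar_kind} {R : realType}.
Local Notation K := (scalars k R).
Local Notation theta := (conj_scalar k R).
Local Notation inj := (inj k R).
Implicit Types H : hilbertType (conj_scalar k R).

Lemma conj_fixed_re (x : K) : theta x = x -> x = inj (re x).
Proof.
move: x; rewrite /re /inj /conj_scalar; case: k => //= -[a b] [] bb.
by have -> : b = 0 by lra.
Qed.

(** Self-adjointness makes [inner (P x) x] its own conjugate, hence real, so its real part decides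
    its sign. *)
Lemma positive_opP H (P : bop H H) :
  positive_op P <-> adj P = P /\ forall x, 0 <= rip (P x) x.
Proof.
split=> -[Psa P0]; split=> // x.
  by rewrite -(@ler_inj k) inj0 -inj_re_ge0.
rewrite (@conj_fixed_re (inner _ _)); first by rewrite -inj0 ler_inj P0.
rewrite -innerC; symmetry; apply: inner_of_rip => y.
by rewrite rip_adjl Psa.
Qed.

Lemma rip_sa H (P : bop H H) x y : adj P = P -> rip (P x) y = rip x (P y).
Proof. by move=> Psa; rewrite rip_adjl Psa. Qed.

(** Positivity of [P] at [x - P x], together with contractivity, bounds [rip (P x) (P x)] by
    [rip (P x) x]; then expand the square. *)
Lemma positive_contraction H (P : bop H H) :
  positive_op P -> (forall x, rnorm (P x) <= rnorm x) ->
  forall x, rnorm (x - P x) <= rnorm x.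
Proof.
move=> /positive_opP[Psa P0] Pc x.
rewrite -ler_sqr ?nnegrE ?rnorm_ge0// -!ripxx.
have h1 := P0 (x - P x); have h2 := rip_le (P (P x)) (P x).
have h3 : rnorm (P (P x)) * rnorm (P x) <= rip (P x) (P x).
  by rewrite ripxx expr2 ler_wpM2r ?rnorm_ge0.
move: h1; rewrite bopB !(ripDl, ripDr, ripNl, ripNr).
rewrite (rip_sa (P x) x)// (ripC x (P x)); have := P0 x; lra.
Qed.

Lemma eq0_harmonic H (x : H) (c : R) :
  (forall n : nat, rnorm x <= c * n.+1%:R^-1) -> x = 0.
Proof.
move=> h; apply/rnorm_eq0/eqP; rewrite eq_le rnorm_ge0 andbT.
exact: le0_harmonic h.
Qed.

Lemma rnorm_scale H (a : K) (x : H) : rnorm (a *: x) = re `|a| * rnorm x.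
Proof. by rewrite /rnorm normrZ -reM -inj_re_ge0. Qed.

(** Completeness in operator norm, phrased by pointwise bounds uniform in [x]. *)
Lemma bop_lim H1 H2 (Y : nat -> bop H1 H2) (c : R) :
  (forall n m x, (n <= m)%N ->
     rnorm (Y m x - Y n x) <= c / n.+1%:R * rnorm x) ->
  exists T : bop H1 H2,
    forall n x, rnorm (T x - Y n x) <= c * n.+1%:R^-1 * rnorm x.
Proof.
move=> YC.
have /choice[f fP] x : exists z,
    forall n, rnorm (z - Y n x) <= c * n.+1%:R^-1 * rnorm x.
  apply: (@complete_harmonic _ _ _ (fun n => Y n x) _ (c * rnorm x)) => [n m|n].
    exact: YC.
  by rewrite mulrAC.
have flin : linear f.
  move=> a x y; apply/eqP; rewrite -subr_eq0; apply/eqP.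
  apply: (@eq0_harmonic _ _ (c * rnorm (a *: x + y) +
    re `|a| * c * rnorm x + c * rnorm y)) => n.
  rewrite (_ : _ - _ = (f (a *: x + y) - Y n (a *: x + y)) +
     - (a *: (f x - Y n x) + (f y - Y n y))); last first.
    by rewrite bopD bopZ scalerBr addrACA -opprD opprB addrA subrK.
  have h1 := fP (a *: x + y) n; have h2 := fP x n; have h3 := fP y n.
  have h4 := rnormD (f (a *: x + y) - Y n (a *: x + y))
    (- (a *: (f x - Y n x) + (f y - Y n y))).
  have h5 := rnormD (a *: (f x - Y n x)) (f y - Y n y).
  have a0 : 0 <= re `|a| by rewrite -(@ler_inj k) inj0 -inj_re_ge0.
  have h6 := ler_wpM2l a0 h2.
  rewrite rnormN in h4; rewrite rnorm_scale in h5.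
  by move: (n.+1%:R^-1) h1 h3 h6 => e h1 h3 h6; lra.
have [M M0 YM] := bop_bound (Y 0).
have [|T TE] := @bop_of_bounded _ _ _ _ f (M + c) flin.
  move=> x; have := fP x 0%N; rewrite invr1 mulr1 => h.
  have := rnormD (f x - Y 0%N x) (Y 0%N x); rewrite subrK.
  by have := YM x; lra.
by exists T => n x; rewrite TE.
Qed.

End SquareRoot.

(** * The iteration for the square root of [1 - S] *)

Section SquareRootExistence.
Context {k : scalar_kind} {R : realType}.
Local Notation K := (scalars k R).
Local Notation theta := (conj_scalar k R).
Local Notation inj := (inj k R).
Implicit Types H : hilbertType (conj_scalar k R).

(* A fixed point [Y] of the iteration [Y := (S + Y ^ 2) / 2] satisfies
   [(1 - Y) ^ 2 = 1 - S].  For [S] of norm at most 1, the increments are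
   dominated in norm by those of the scalar iteration from [S = 1]. *)
Fixpoint sqrt_iter_scalar n : R :=
  if n is m.+1 then (1 + sqrt_iter_scalar m ^+ 2) / 2 else 0.

Fixpoint sqrt_iter H (S : bop H H) n : bop H H :=
  if n is m.+1 then inj 2^-1 *: (S + sqrt_iter S m \bo sqrt_iter S m) else 0.

Local Notation y := sqrt_iter_scalar.

Lemma sqrt_iter_scalar_ge0 n : 0 <= y n.
Proof. by case: n => //= n; rewrite divr_ge0// addr_ge0// sqr_ge0. Qed.

(** The gap [u = 1 - y n] evolves by [u - u^2 / 2], which decays like [2 / n]: the rate required by
    [bop_lim]. *)
Lemma sqrt_iter_scalar_gap n : 0 <= 1 - y n <= 2 / n.+1%:R.
Proof.
elim: n => [|n /andP[h0 h1]] /=; first by rewrite subr0 invr1; lra.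
have y0 := sqrt_iter_scalar_ge0 n.
have e0 : 0 < n.+1%:R :> R by rewrite ltr0n.
rewrite ler_pdivlMr ?ltr0n//; rewrite ler_pdivlMr// in h1.
have -> : n.+2%:R = n.+1%:R + 1 :> R by rewrite -natr1.
have e1 : 1 <= n.+1%:R :> R by rewrite ler1n.
move: (n.+1%:R) e0 e1 h1 => m m0 m1 h1.
move: (y n) y0 h0 h1 => a a0 h0 h1.
apply/andP; split; first by nra.
(* with [u = 1 - a] and [u m <= 2] the claim is [(u - u^2/2)(m+1) <= 2] *)
have [mm|mm] := leP 2 m; last by nra.
have h2 : 0 <= (2 - (1 - a) * m) * (2 * m - (m + 1) * (1 - a)) by nra.
nra.
Qed.

Lemma sqrt_iter_scalar_le n : y n <= y n.+1.
Proof. by have := sqr_ge0 (1 - y n) => /=; nra. Qed.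

Section Iteration.
Context H (S : bop H H) (Sc : forall x, rnorm (S x) <= rnorm x).
Local Notation Y := (sqrt_iter S).

Lemma sqrt_iterS n x : Y n.+1 x = inj 2^-1 *: (S x + Y n (Y n x)).
Proof. by []. Qed.

Lemma rnorm_sqrt_iter n x : rnorm (Y n x) <= y n * rnorm x.
Proof.
elim: n x => [|n IH] x; first by rewrite /= rnorm0 mul0r.
rewrite sqrt_iterS rnormZ ger0_norm ?invr_ge0//=.
have := rnormD (S x) (Y n (Y n x)); have := Sc x; have := IH (Y n x).
have := ler_wpM2l (sqrt_iter_scalar_ge0 n) (IH x).
lra.
Qed.

(** With [Y' = Y n.+1] and [Y = Y n], split [Y' Y' - Y Y] as [Y' (Y' - Y) + (Y' - Y) Y]; the scalar
    bounds add up to [y n.+1 ^+ 2 - y n ^+ 2]. *)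
Lemma sqrt_iter_step n x : rnorm (Y n.+1 x - Y n x) <= (y n.+1 - y n) * rnorm x.
Proof.
elim: n x => [|n IH] x.
  have := rnorm_sqrt_iter 1 x; rewrite /= !subr0; lra.
rewrite [Y n.+2 x]sqrt_iterS [in X in _ - X]sqrt_iterS.
rewrite -scalerBr opprD addrACA subrr add0r.
rewrite -(subrK (Y n.+1 (Y n x)) (Y n.+1 (Y n.+1 x))) -bopB -addrA.
rewrite rnormZ ger0_norm ?invr_ge0//.
set u := Y n.+1 x - Y n x.
have := rnormD (Y n.+1 u) (Y n.+1 (Y n x) - Y n (Y n x)).
have := rnorm_sqrt_iter n.+1 u; have := IH (Y n x).
have h0 : 0 <= y n.+1 - y n by rewrite subr_ge0 sqrt_iter_scalar_le.
have := ler_wpM2l (sqrt_iter_scalar_ge0 n.+1) (IH x).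
have := ler_wpM2l h0 (rnorm_sqrt_iter n x).
have : y n.+2 = (1 + y n.+1 ^+ 2) / 2 by [].
have : y n.+1 = (1 + y n ^+ 2) / 2 by [].
rewrite -/u; move: (y n) (y n.+1) (y n.+2) => a b c; nra.
Qed.

Lemma sqrt_iter_cauchy n m x :
  (n <= m)%N -> rnorm (Y m x - Y n x) <= 2 / n.+1%:R * rnorm x.
Proof.
move=> nm; apply: (@le_trans _ _ ((y m - y n) * rnorm x)); last first.
  rewrite ler_wpM2r ?rnorm_ge0//; have /andP[_] := sqrt_iter_scalar_gap n.
  by have /andP[+ _] := sqrt_iter_scalar_gap m; move: (2 / n.+1%:R) => e; lra.
move: nm => /subnKC <-; elim: (m - n)%N => [|j IH].
  by rewrite addn0 !subrr rnorm0 mul0r.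
rewrite addnS -(subrK (Y (n + j)%N x) (Y (n + j).+1 x)) -addrA.
rewrite (le_trans (rnormD _ _))//; have := sqrt_iter_step (n + j) x; lra.
Qed.

Lemma sqrt_iter_sa n : adj S = S -> adj (Y n) = Y n.
Proof.
move=> Ssa; elim: n => [|n IH]; last by rewrite /= adjZ adjD adjM IH Ssa.
by apply: adj_unique => u v; rewrite !bop_zeroE rip0l rip0r.
Qed.

Lemma sqrt_iter_comm (B : bop H H) n :
  (forall x, B (S x) = S (B x)) -> forall x, B (Y n x) = Y n (B x).
Proof.
move=> BS; elim: n => [|n IH] x; first by rewrite !bop_zeroE bop0.
by rewrite !sqrt_iterS bopZ bopD BS !IH.
Qed.

(** The third clause is the fixed point equation. The last one, commutation with all that commutes
    with [S], serves the uniqueness of square roots. *)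
Lemma sqrt_iter_lim : exists T : bop H H,
  [/\ adj S = S -> adj T = T, forall x, rnorm (T x) <= rnorm x,
      forall x, T (T x) = T x + T x - S x &
      forall B : bop H H, (forall x, B (S x) = S (B x)) ->
        forall x, B (T x) = T (B x)].
Proof.
have [T TP] := bop_lim sqrt_iter_cauchy.
have Tc x : rnorm (T x) <= rnorm x.
  rewrite -subr_le0; apply: (le0_harmonic (c := 2 * rnorm x)) => n.
  have := TP n x; have := rnormD (T x - Y n x) (Y n x); rewrite subrK.
  have := rnorm_sqrt_iter n x; have /andP[h _] := sqrt_iter_scalar_gap n.
  have : y n * rnorm x <= 1 * rnorm x by rewrite ler_wpM2r ?rnorm_ge0//; lra.
  by move: (n.+1%:R^-1) => e; lra.
have e0 n : 0 <= n.+1%:R^-1 :> R by rewrite invr_ge0 ler0n.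
exists T; split=> //.
- move=> Ssa; apply: adj_unique => u v; apply/eqP; rewrite -subr_eq0 -normr_eq0.
  rewrite eq_le normr_ge0 andbT.
  apply: (le0_harmonic (c := 4 * rnorm u * rnorm v)) => n.
  rewrite (_ : _ - _ = rip (T u - Y n u) v + rip u (Y n v - T v)); last first.
    by rewrite ripDl ripDr ripNl ripNr (rip_sa _ _ (sqrt_iter_sa n Ssa)); lra.
  have h1 := norm_rip_le (T u - Y n u) v; have h2 := norm_rip_le u (Y n v - T v).
  have h3 := ler_wpM2r (rnorm_ge0 v) (TP n u).
  have h4 := ler_wpM2l (rnorm_ge0 u) (TP n v).
  rewrite rnorm_subC in h4.
  have := ler_normD (rip (T u - Y n u) v) (rip u (Y n v - T v)).
  by move: (n.+1%:R^-1) h1 h2 h3 h4 => e; lra.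
- move=> x; apply/eqP; rewrite -subr_eq0; apply/eqP.
  apply: (@eq0_harmonic _ _ _ _ (8 * rnorm x)) => n.
  (* The recursion cancels the iterates and leaves only errors of order [1 / n.+1]. *)
  have -> : T (T x) - (T x + T x - S x) =
      T (T x - Y n x) + (T (Y n x) - Y n (Y n x)) -
      ((T x - Y n.+1 x) + (T x - Y n.+1 x)).
    rewrite bopB addrA subrK [X in _ = _ - X]addrACA -opprD.
    have -> : Y n.+1 x + Y n.+1 x = S x + Y n (Y n x).
      rewrite sqrt_iterS -scalerDl -injD (_ : 2^-1 + 2^-1 = 1); last by lra.
      by rewrite inj1 scale1r.
    by rewrite !opprB addrA addrA addrACA addNr addr0.
  have h1 := TP n x; have h2 := TP n (Y n x); have h3 := TP n.+1 x.
  have h4 : rnorm (Y n x) <= rnorm x.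
    rewrite (le_trans (rnorm_sqrt_iter n x))// ler_piMl ?rnorm_ge0//.
    by have /andP[+ _] := sqrt_iter_scalar_gap n; lra.
  have h5 := Tc (T x - Y n x).
  have h6 : n.+2%:R^-1 <= n.+1%:R^-1 :> R.
    by rewrite lef_pV2 ?posrE ?ltr0n// ler_nat.
  have h7 := rnormD (T (T x - Y n x) + (T (Y n x) - Y n (Y n x)))
    (- ((T x - Y n.+1 x) + (T x - Y n.+1 x))).
  have h8 := rnormD (T (T x - Y n x)) (T (Y n x) - Y n (Y n x)).
  have h9 := rnormD (T x - Y n.+1 x) (T x - Y n.+1 x).
  have h10 := ler_wpM2l (e0 n) h4; have h11 := ler_wpM2r (rnorm_ge0 x) h6.
  rewrite rnormN in h7; move: (n.+1%:R^-1) (n.+2%:R^-1) h1 h2 h3 h10 h11 => e e'.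
  by lra.
- move=> B BS x; apply/eqP; rewrite -subr_eq0; apply/eqP.
  have [M M0 BM] := bop_bound B.
  apply: (@eq0_harmonic _ _ _ _ (2 * M * rnorm x + 2 * rnorm (B x))) => n.
  rewrite (_ : _ - _ = B (T x - Y n x) - (T (B x) - Y n (B x))); last first.
    by rewrite bopB (sqrt_iter_comm n BS) opprB addrA subrK.
  have h1 := TP n (B x); have h2 := ler_wpM2l M0 (TP n x).
  have h3 := BM (T x - Y n x).
  have := rnormD (B (T x - Y n x)) (- (T (B x) - Y n (B x))); rewrite rnormN.
  by move: (n.+1%:R^-1) h1 h2 => e; lra.
Qed.

End Iteration.
End SquareRootExistence.

(** * Existence and uniqueness of positive square roots *)

Section SqrtPolar.
Context {k : scalar_kind} {R : realType}.
Local Notation K := (scalars k R).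
Local Notation theta := (conj_scalar k R).
Local Notation inj := (inj k R).
Implicit Types H : hilbertType (conj_scalar k R).

Lemma sqrt_exists H (P : bop H H) : positive_op P ->
  exists Q : bop H H, [/\ positive_op Q, Q \bo Q = P &
    forall B : bop H H, (forall x, B (P x) = P (B x)) ->
      forall x, B (Q x) = Q (B x)].
Proof.
move=> Ppos; have [Psa P0] := (positive_opP P).1 Ppos.
have [M0 M0ge M0P] := bop_bound P.
(* The added 1 keeps [M] invertible when [M0 = 0]; [P / M] is then a positive contraction. *)
pose M := M0 + 1; have Mgt : 0 < M by rewrite /M; lra.
have [I IE] := idbop_ex H.
have Isa : adj I = I by apply: adj_unique => x y; rewrite !IE.
pose P1 := inj M^-1 *: P.
have P1pos : positive_op P1.
  apply/positive_opP; split=> [|x]; first by rewrite adjZ Psa.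
  by rewrite ripZl mulr_ge0 ?invr_ge0 ?P0// ltW.
have P1c x : rnorm (P1 x) <= rnorm x.
  rewrite rnormZ ger0_norm ?invr_ge0 ?(ltW Mgt)// mulrC ler_pdivrMr//.
  have := M0P x; have := rnorm_ge0 x; rewrite /M; lra.
pose S := I - P1.
have SE x : S x = x - P1 x by rewrite /S bop_addE bop_oppE IE.
have Sc x : rnorm (S x) <= rnorm x by rewrite SE positive_contraction.
have [T [Tsa Tc TT TB]] := sqrt_iter_lim Sc.
have {}Tsa : adj T = T by apply: Tsa; rewrite adjD adjN Isa adjZ Psa.
pose c := Num.sqrt M.
have c0 : 0 <= c by rewrite sqrtr_ge0.
have cc : c * c = M by rewrite -expr2 sqr_sqrtr// ltW.
(* As [(1 - T)^2 = 1 - S = P / M], the factor [sqrt M] undoes the normalization. *)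
pose Q := inj c *: (I - T).
have QE x : Q x = inj c *: (x - T x) by rewrite /Q bop_scaleE bop_addE bop_oppE IE.
exists Q; split.
- apply/positive_opP; split=> [|x]; first by rewrite adjZ adjD adjN Isa Tsa.
  rewrite QE ripZl mulr_ge0// ripDl ripNl subr_ge0 ripxx.
  by rewrite (le_trans (rip_le _ _))// expr2 ler_wpM2r ?rnorm_ge0.
- apply/bop_ext => x; rewrite -[LHS]/(Q (Q x)) !QE bopZ -scalerBr scalerA -injM cc.
  have -> : x - T x - T (x - T x) = P1 x.
    rewrite bopB TT SE opprB [T x + T x - _]addrAC addrK addrA subrK.
    by rewrite opprB addrC subrK.
  by rewrite /P1 bop_scaleE scalerA -injM mulfV ?gt_eqF// inj1 scale1r.
- move=> B BP x; rewrite !QE bopZ bopB TB// => u.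
  by rewrite !SE bopB /P1 !bop_scaleE bopZ BP.
Qed.

Lemma sa_form_eq0 H (A : bop H H) :
  adj A = A -> (forall x, rip (A x) x = 0) -> A = 0.
Proof.
move=> Asa A0; apply/bop_ext => x; apply: rip_inj => y; rewrite bop_zeroE rip0r.
have := A0 (x + y); rewrite bopD !(ripDl, ripDr) !A0.
by rewrite (rip_sa y x Asa) (ripC (A x)); lra.
Qed.

Lemma sa_sqr_eq0 H (A : bop H H) x : adj A = A -> A (A x) = 0 -> A x = 0.
Proof.
move=> Asa AA; apply/rnorm_eq0/eqP; rewrite -sqrf_eq0 -ripxx rip_sa// AA rip0r//.
Qed.

(* With [D = Q0 - Q1], [Q0 + Q1] vanishes on the range of [D], whence
   [D ^ 3 = 0]. *)
Lemma sqrt_comm_unique H (Q0 Q1 : bop H H) : positive_op Q0 -> positive_op Q1 ->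
  Q0 \bo Q0 = Q1 \bo Q1 -> Q0 \bo Q1 = Q1 \bo Q0 -> Q0 = Q1.
Proof.
move=> /positive_opP[Q0sa Q0p] /positive_opP[Q1sa Q1p] QQ QC.
pose D := Q0 - Q1.
have Dsa : adj D = D by rewrite adjD adjN Q0sa Q1sa.
have DE x : D x = Q0 x - Q1 x by [].
have QQE x : Q0 (Q0 x) = Q1 (Q1 x) by have := congr1 (fun T : bop H H => T x) QQ.
have QCE x : Q0 (Q1 x) = Q1 (Q0 x) by have := congr1 (fun T : bop H H => T x) QC.
have sumD x : Q0 (D x) + Q1 (D x) = 0.
  by rewrite DE !bopB QQE QCE addrA subrK subrr.
have D3 : D \bo (D \bo D) = 0.
  apply: sa_form_eq0 => [|x]; first by rewrite !adjM Dsa; apply: bop_ext.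
  rewrite /= (rip_sa (D (D x)) x Dsa).
  have h := congr1 (fun z => rip z (D x)) (sumD x).
  rewrite /= ripDl rip0l in h; have := Q0p (D x); have := Q1p (D x).
  by rewrite (DE (D x)) ripDl ripNl; lra.
have D3E x : D (D (D x)) = 0 by have := congr1 (fun T : bop H H => T x) D3.
have D1 x : D x = 0 by apply: sa_sqr_eq0 => //; apply: sa_sqr_eq0.
apply/bop_ext => x; apply/eqP; rewrite -subr_eq0 -DE; exact/eqP.
Qed.

(** A root of [P] commutes with [P], hence with the root built in [sqrt_exists]; commuting positive
    roots coincide. *)
Lemma sqrt_unique H (P Q0 Q1 : bop H H) : positive_op P ->
  positive_op Q0 -> positive_op Q1 -> Q0 \bo Q0 = P -> Q1 \bo Q1 = P -> Q0 = Q1.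
Proof.
move=> Ppos Q0p Q1p Q0P Q1P.
have [Q [Qp QP QB]] := sqrt_exists Ppos.
suff eqQ Q' : positive_op Q' -> Q' \bo Q' = P -> Q' = Q.
  by rewrite (eqQ _ Q0p Q0P) (eqQ _ Q1p Q1P).
move=> Q'p Q'P; apply: sqrt_comm_unique => //; first by rewrite QP.
by apply: bop_ext => x /=; apply: QB => z; rewrite -Q'P.
Qed.

Lemma sqrt_opP H (P : bop H H) : positive_op P ->
  positive_op (sqrt_op P) /\ sqrt_op P \bo sqrt_op P = P.
Proof.
move=> Ppos; have [Q [Qp QP _]] := sqrt_exists Ppos.
by have /(xgetPex 0) : [set Q | positive_op Q /\ Q \bo Q = P] !=set0 by exists Q.
Qed.

Lemma sqrt_op_eq H (P Q : bop H H) :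
  positive_op P -> positive_op Q -> Q \bo Q = P -> sqrt_op P = Q.
Proof.
move=> Ppos Qpos QP; have [sp sP] := sqrt_opP Ppos.
exact: sqrt_unique sP QP.
Qed.

(** * Absolute values, polar decomposition and reduced solutions *)

Lemma adj_comp_positive H1 H2 (T : bop H1 H2) : positive_op (adj T \bo T).
Proof.
apply/positive_opP; split=> [|x]; first by rewrite adjM adjK.
by rewrite /= -rip_adjr ripxx sqr_ge0.
Qed.

Lemma abs_op_positive H1 H2 (T : bop H1 H2) : positive_op (abs_op T).
Proof. exact: (sqrt_opP (adj_comp_positive T)).1. Qed.

Lemma abs_opM H1 H2 (T : bop H1 H2) : abs_op T \bo abs_op T = adj T \bo T.
Proof. exact: (sqrt_opP (adj_comp_positive T)).2. Qed.

Lemma abs_op_sa H1 H2 (T : bop H1 H2) : adj (abs_op T) = abs_op T.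
Proof. exact: (abs_op_positive T).1. Qed.

Lemma rip_abs_op H1 H2 (T : bop H1 H2) x y :
  rip (abs_op T x) (abs_op T y) = rip (T x) (T y).
Proof.
rewrite rip_sa ?abs_op_sa// rip_adjl -[RHS]/(rip x ((adj T \bo T) y)).
by rewrite -abs_opM.
Qed.

Lemma rnorm_abs_op H1 H2 (T : bop H1 H2) x : rnorm (abs_op T x) = rnorm (T x).
Proof.
by apply: (@pexpIrn _ 2) => //; rewrite ?nnegrE ?rnorm_ge0// -!ripxx rip_abs_op.
Qed.

Lemma orthocomplement_nullspaceP H1 H2 (T : bop H1 H2) x :
  orthocomplement (nullspace T) x <-> forall u, T u = 0 -> rip x u = 0.
Proof.
split=> h u Tu; first by rewrite /rip (h u Tu) re0.
apply: re_mulJ_eq0; rewrite -innerZr -/(rip _ _) h//.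
by rewrite bopZ Tu scaler0.
Qed.

(** Since [|T|] and [T] have equal norms at each point, [majorized_factor] gives [U] with
    [adj T \bo U = |T|] and values orthogonal to the complement of the range of [T]. *)
Lemma polar_exists H1 H2 (T : bop H1 H2) : exists U : bop H1 H2,
  [/\ partial_isometry U, nullspace U = nullspace T, T = U \bo abs_op T &
    forall x, adj U (U (abs_op T x)) = abs_op T x].
Proof.
have Psa := abs_op_sa T.
have [|U [UP Uo _]] := @majorized_factor _ _ _ _ _ T (abs_op T) 1 ler01.
  by move=> w; rewrite rnorm_abs_op mul1r.
have TE x : U (abs_op T x) = T x.
  have o w : rip (T w) (U (abs_op T x) - T x) = 0.
    by rewrite ripDr ripNr UP rip_abs_op subrr.
  apply/eqP; rewrite -subr_eq0 -[_ == _]/(_ - _ == 0); apply/eqP/rnorm_eq0/eqP.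
  by rewrite -sqrf_eq0 -ripxx ripDl ripNl o Uo// subrr.
have UUP x : adj U (U (abs_op T x)) = abs_op T x.
  by apply: rip_inj => y; rewrite -rip_adjl TE ripC UP ripC.
have nullU x : U x = 0 <-> T x = 0.
  split=> [Ux|Tx].
    apply: rnorm_eq0; rewrite -rnorm_abs_op (_ : abs_op T x = 0) ?rnorm0//.
    by apply: rip_inj => w; rewrite rip0r -(rip_sa _ _ Psa) -UP Ux rip0r.
  apply: rnorm_eq0; apply/eqP; rewrite -sqrf_eq0 -ripxx Uo// => w.
  have -> : rip (T w) (U x) = rip w (abs_op T x) by rewrite UP rip_sa.
  rewrite (_ : abs_op T x = 0) ?rip0r//.
  by apply: rnorm_eq0; rewrite rnorm_abs_op Tx rnorm0.
exists U; split=> //.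
(* [adj U (U x) - x] is killed by [|T|], hence by [U], so it is orthogonal to [x]. *)
- move=> x /orthocomplement_nullspaceP xo.
  rewrite -!inj_rnorm; congr inj.
  apply: (@pexpIrn _ 2) => //; rewrite ?nnegrE ?rnorm_ge0//.
  rewrite -!ripxx rip_adjl; apply/eqP; rewrite -subr_eq0 -ripNr -ripDr; apply/eqP.
  apply: xo; apply/nullU/rnorm_eq0; rewrite -rnorm_abs_op.
  rewrite (_ : abs_op T _ = 0) ?rnorm0//; apply: rip_inj => y; rewrite rip0r.
  rewrite -(rip_sa _ _ Psa) ripDr ripNr -rip_adjl [X in X - _]ripC rip_adjl UUP.
  by rewrite (ripC x) subrr.
- by apply/seteqP; split=> x; apply nullU.
- by apply: bop_ext => x /=; rewrite TE.
Qed.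

(** Two polar factors agree on the range of [|T|] and on the nullspace of [T], hence everywhere. So
    the chosen one inherits the last clause from the constructed one. *)
Lemma polar_factorP H1 H2 (T : bop H1 H2) (U := polar_factor T) :
  [/\ forall x, U (abs_op T x) = T x, forall x, U x = 0 <-> T x = 0 &
      forall x, adj U (U (abs_op T x)) = abs_op T x].
Proof.
have [U0 [U0pi U0n U0T U0P]] := polar_exists T.
have /(xgetPex 0) [_ Un UT] : [set U : bop H1 H2 | [/\ partial_isometry U,
  nullspace U = nullspace T & T = U \bo abs_op T]] !=set0 by exists U0.
rewrite -/U0 -/(polar_factor T) -/U in Un UT.
have TE x : U (abs_op T x) = T x by rewrite [in RHS]UT.
have nullU x : U x = 0 <-> T x = 0.
  by rewrite -[U x = 0]/(nullspace U x) Un.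
have nullU0 x : T x = 0 -> U0 x = 0.
  by rewrite -[T x = 0]/(nullspace T x) -U0n.
suff UU0 : U = U0 by split=> // x; rewrite UU0 U0P.
pose D := U - U0; suff D0 : adj D = 0.
  apply/eqP; rewrite -subr_eq0 -/D -[D]adjK D0; apply/eqP/adj_unique => x y.
  by rewrite !bop_zeroE rip0l rip0r.
apply: bop_ext => y; rewrite bop_zeroE; apply/rnorm_eq0/eqP.
rewrite -sqrf_eq0 -ripxx -rip_adjr /D bop_addE bop_oppE.
have Ty : T (adj D y) = 0.
  apply/rnorm_eq0; rewrite -rnorm_abs_op (_ : abs_op T _ = 0) ?rnorm0//.
  apply: rip_inj => x; rewrite rip0r -(rip_sa _ _ (abs_op_sa T)) -rip_adjl.
  rewrite /D bop_addE bop_oppE TE {1}U0T subrr rip0l//.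
by rewrite (nullU _).2// nullU0// subrr rip0r.
Qed.

(** The right side is positive, and its square is [T \bo adj T] because [adj U \bo U] fixes the
    range of [|T|]. *)
Lemma abs_adjE H1 H2 (T : bop H1 H2) (U := polar_factor T) :
  abs_op (adj T) = U \bo abs_op T \bo adj U.
Proof.
have [UT _ UUP] := polar_factorP T; rewrite -/U in UT UUP.
have Psa := abs_op_sa T; have [_ P0] := (positive_opP _).1 (abs_op_positive T).
apply: sqrt_op_eq; first exact: adj_comp_positive.
  apply/positive_opP; split=> [|x]; first by rewrite !adjM adjK Psa; exact: bop_ext.
  by rewrite /= rip_adjl.
apply: bop_ext => x /=; rewrite UUP adjK -UT; congr (U (abs_op T _)).
apply: rip_inj => y; rewrite -rip_adjl -UT rip_adjl.
by rewrite -(rip_sa _ _ Psa) ripC.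
Qed.

(** With [Q] the root of [|T|], [U Q (adj U)] is positive and squares to [|adj T|], so it is the
    root of the latter; [QV] then removes [adj U \bo U]. *)
Lemma sqrt_abs_adj_polar H1 H2 (T : bop H1 H2) (U := polar_factor T) x :
  sqrt_op (abs_op (adj T)) (U x) = U (sqrt_op (abs_op T) x).
Proof.
have [UT _ UUP] := polar_factorP T; rewrite -/U in UT UUP.
have [/positive_opP[Qsa Q0] QQ] := sqrt_opP (abs_op_positive T).
set Q := sqrt_op (abs_op T) in Qsa Q0 QQ *.
have Psa := abs_op_sa T.
have QV y : Q (adj U (U y)) = Q y.
  apply/eqP; rewrite -subr_eq0 -bopB; apply/eqP/sa_sqr_eq0 => //.
  rewrite -[Q (Q _)]/((Q \bo Q) _) QQ; apply: rip_inj => z.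
  rewrite rip0r -(rip_sa _ _ Psa) ripDr ripNr -rip_adjl [X in X - _]ripC rip_adjl UUP.
  by rewrite (ripC y) subrr.
have VQ y : adj U (U (Q y)) = Q y.
  apply: rip_inj => z; rewrite -rip_adjl -(rip_sa _ _ Qsa) -[in RHS]QV.
  by rewrite (rip_sa _ _ Qsa) -rip_adjr.
rewrite (@sqrt_op_eq _ _ (U \bo Q \bo adj U)) /= ?QV//.
- exact: abs_op_positive.
- apply/positive_opP; split=> [|y]; first by rewrite !adjM adjK Qsa; exact: bop_ext.
  by rewrite /= rip_adjl.
- by rewrite abs_adjE -/U; apply: bop_ext => y /=; rewrite VQ -QQ.
Qed.

Lemma reduced_solution_eq H1 H2 H3 (X : bop H2 H3) (Y : bop H1 H3)
    (D : bop H1 H2) :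
  X \bo D = Y -> (forall y u, X u = 0 -> rip (D y) u = 0) ->
  reduced_solution X Y = D.
Proof.
move=> XD Do.
have /(xgetPex 0) [XE Eo] : [set D : bop H1 H2 | X \bo D = Y /\
    range D `<=` orthocomplement (nullspace X)] !=set0.
  by exists D; split=> // _ [y _ <-]; apply/orthocomplement_nullspaceP/Do.
rewrite -/(reduced_solution X Y) in XE Eo *.
set E := reduced_solution X Y in XE Eo *.
apply: bop_ext => y; apply/eqP; rewrite -subr_eq0; apply/eqP/rnorm_eq0/eqP.
have XED : X (E y - D y) = 0.
  rewrite bopB -[X (E y)]/((X \bo E) y) -[X (D y)]/((X \bo D) y).
  by rewrite XE XD subrr.
rewrite -sqrf_eq0 -ripxx ripDl ripNl Do// subr0.
have /orthocomplement_nullspaceP -> // : orthocomplement (nullspace X) (E y).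
by apply: Eo; exists y.
Qed.

End SqrtPolar.

(** * Evaluation of the parallel sum through preimages *)

Section ParallelSum.
Context {k : scalar_kind} {R : realType}.
Local Notation K := (scalars k R).
Local Notation theta := (conj_scalar k R).
Local Notation inj := (inj k R).
Context {H1 H2 : hilbertType (conj_scalar k R)}.
Implicit Types A B C T X : bop H1 H2.

(** With [Z] supplied by [douglas], this turns a range inclusion of adjoints into an inclusion of
    nullspaces. *)
Lemma adj_factor_null A T (Z : bop H2 H2) x :
  adj T \bo Z = adj A -> T x = 0 -> A x = 0.
Proof.
move=> TZ Tx; apply: rip_inj => w; rewrite rip0r rip_adjr ripC.
by rewrite -TZ /= -rip_adjl Tx rip0l.
Qed.

Lemma parallel_sumE A B x y : parallel_summable A B ->
  (A + B) y = A x -> parallel_sum A B x = A x - A y.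
Proof.
move=> [/douglas[Y TY _] ]; rewrite -adjD => /douglas[Z TZ _].
set T := A + B in TY TZ *; move=> Tyx.
have TYE z : T (Y z) = A z by rewrite -TY.
have -> : A y = A (Y x).
  apply/eqP; rewrite -subr_eq0 -bopB; apply/eqP/(adj_factor_null TZ).
  by rewrite bopB Tyx TYE subrr.
have [UT Un UUP] := polar_factorP T.
have [/positive_opP[Qsa Q0] QQ] := sqrt_opP (abs_op_positive T).
rewrite /parallel_sum -adjD -/T.
set U := polar_factor T in UT Un UUP *; set P := abs_op T in UT UUP QQ Qsa *.
set Q := sqrt_op P in Qsa Q0 QQ *.
have QQE z : Q (Q z) = P z by rewrite -QQ.
(* [E = Q Y], as [|adj T|^(1/2) U Q Y = U Q Q Y = T Y = A]. *)
rewrite (reduced_solution_eq (D := Q \bo Y)); first last.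
- move=> z u; rewrite /= sqrt_abs_adj_polar -/U -/P -/Q => /Un TQu.
  rewrite rip_sa// (_ : Q u = 0) ?rip0r//.
  (* [T (Q u) = 0] means [Q^3 u = 0], and self-adjointness lowers the power twice. *)
  do 2 apply: sa_sqr_eq0 => //.
  by rewrite QQE; apply: rnorm_eq0; rewrite rnorm_abs_op TQu rnorm0.
- apply: bop_ext => z /=; rewrite sqrt_abs_adj_polar -/U -/P -/Q.
  by rewrite QQE UT TYE.
(* [F = Q (adj U) Z], as [Q Q (adj U) Z = adj T \bo Z = adj A]. *)
rewrite (reduced_solution_eq (D := Q \bo adj U \bo Z)); first last.
- by move=> z u Qu; rewrite /= rip_sa// Qu rip0r.
- apply: bop_ext => z /=; rewrite QQE -TZ /=.
  apply: rip_inj => w; rewrite -[RHS]rip_adjl -UT rip_adjl.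
  by rewrite -(rip_sa _ _ (abs_op_sa T)).
rewrite bop_addE bop_oppE; congr (_ - _).
(* [adj F \bo E = (adj Z) U |T| Y = (adj Z) T Y = A Y]. *)
apply: rip_inj => w /=; rewrite rip_adjr adjK /= (rip_sa _ _ Qsa) QQE.
by rewrite -rip_adjr UT [RHS]rip_adjr -TZ /= -rip_adjr.
Qed.

Lemma adj_null_factor A T (Y : bop H1 H1) :
  T \bo Y = A -> forall w, adj T w = 0 -> adj A w = 0.
Proof. by move=> <- w Tw; rewrite adjM /= Tw bop0. Qed.

End ParallelSum.

(** * Solving [A : X = C] *)

Theorem corollary5p13 (k : scalar_kind) (R : realType)
    (H1 H2 : hilbertType (conj_scalar k R)) (A C : bop H1 H2)
    (hC : same_range_perturbations A C) :
  (exists X : bop H1 H2, parallel_summable A X /\ parallel_sum A X = C) /\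
  parallel_summable C (- A) /\
  unique (fun X : bop H1 H2 =>
      [/\ parallel_summable A X, parallel_sum A X = C,
          range (A + X) = range A & range (adj (A + X)) = range (adj A)])
    (parallel_sum C (- A)).
Proof.
have [rT rTs] := hC; set T := C - A in rT rTs.
have CE x : C x = T x + A x by rewrite /T bop_addE bop_oppE subrK.
have CsE x : adj C x = adj T x + adj A x.
  by rewrite /T adjD adjN bop_addE bop_oppE subrK.
have [|Y TY _] := @douglas _ _ _ _ _ A T; first by rewrite rT.
have [|Z TZ _] := @douglas _ _ _ _ _ (adj A) (adj T); first by rewrite rTs.
have TYE x : T (Y x) = A x by rewrite -TY.
have TZE x : adj T (Z x) = adj A x by rewrite -TZ.
have nullT x : T x = 0 -> A x = 0 by exact: adj_factor_null TZ.
have nullTs x : adj T x = 0 -> adj A x = 0 by exact: adj_null_factor TY x.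
have nullA x : A x = 0 -> T x = 0.
  have [|W AW _] := @douglas _ _ _ _ _ (adj T) (adj A); first by rewrite rTs.
  exact: adj_factor_null AW.
have CAs : parallel_summable C (- A).
  split=> _ [x _ <-].
    (* [T (x + Y x) = T x + A x = C x]. *)
    by exists (x + Y x) => //; rewrite -/T bopD TYE CE.
  by exists (x + Z x) => //; rewrite adjN -adjN -adjD -/T bopD TZE CsE.
set X0 := parallel_sum C (- A).
have AX0 x : (A + X0) x = - A (Y x).
  rewrite bop_addE /X0 (parallel_sumE (y := x + Y x))//; last first.
    by rewrite -/T bopD TYE CE.
  by rewrite bopD opprD [X in _ + X]addrA subrr add0r CE TYE opprD addrA subrr add0r.
have AX0s x : adj (A + X0) x = - adj A (Z x).
  have -> : A + X0 = - (A \bo Y) by apply: bop_ext => z; rewrite AX0.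
  by rewrite adjN bop_oppE adjM /= -TZE -[adj Y _]/((adj Y \bo adj T) _) -adjM TY.
have rAX0 : range (A + X0) = range A.
  apply/seteqP; split=> _ [x _ <-]; first by exists (- Y x); rewrite // bopN AX0.
  (* From [T x = A u = T (Y u)], the vector [Y u - x] lies in the nullspace of [T], hence in that of
     [A], so [A x = A (Y u)]. *)
  have [u _ ux] : range A (T x) by rewrite -rT; exists x.
  exists (- u) => //; rewrite AX0 !bopN opprK; apply/eqP.
  by rewrite -subr_eq0 -bopB; apply/eqP/nullT; rewrite bopB TYE ux subrr.
have rAX0s : range (adj (A + X0)) = range (adj A).
  apply/seteqP; split=> _ [x _ <-]; first by exists (- Z x); rewrite // bopN AX0s.
  have [u _ ux] : range (adj A) (adj T x) by rewrite -rTs; exists x.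
  exists (- u) => //; rewrite AX0s !bopN opprK; apply/eqP.
  by rewrite -subr_eq0 -bopB; apply/eqP/nullTs; rewrite bopB TZE ux subrr.
have AX0p : parallel_summable A X0 by split; rewrite ?rAX0// -adjD rAX0s.
have AX0C : parallel_sum A X0 = C.
  apply: bop_ext => x; have [y _ yx] : range (A + X0) (A x).
    by rewrite rAX0; exists x.
  rewrite (parallel_sumE AX0p yx) CE addrC; congr (_ + _).
  rewrite AX0 in yx.
  (* Passing from [A] to [T] gives [A y = - T x], which is what is missing from
     [C x = T x + A x]. *)
  have /nullA : A (Y y + x) = 0 by rewrite bopD -yx subrr.
  by rewrite bopD TYE => /eqP; rewrite addr_eq0 => /eqP ->; rewrite opprK.
split; first by exists X0.
split=> //; split=> // X [AXp AXC rAX _].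
apply: bop_ext => x.
(* Evaluating [A : X = C] at [z] gives [T z = - A x = - T (Y x)], so [(A + X) x = A z = - A (Y x)],
   the value already found for [X0]. *)
have [z _ zx] : range A ((A + X) x) by rewrite -rAX; exists x.
apply: (addrI (A x)); rewrite -!bop_addE AX0 -zx.
have := parallel_sumE AXp (esym zx); rewrite AXC CE addrC => /addrI Tz.
have /nullT : T (Y x + z) = 0 by rewrite bopD TYE Tz subrr.
by rewrite bopD => /eqP; rewrite addr_eq0 => /eqP ->; rewrite opprK.
Qed.
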